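(* (Combinatorial Lemma) Let $\Gamma$ be a piecewise $C^2$ graph in $\mathbb{R}^3$ and let any parameterization $\Gamma'$ of the double of $\Gamma$ be given. For all $q\in\Gamma$ and for almost all $e\in S^2$, $$\mathrm{nlm}(e,q)=\frac12\big[d^-(e,q)-d^+(e,q)\big].$$
   Context: $\Gamma$ is a connected finite graph; after adding finitely many vertices of degree 2, each edge is a regular $C^2$ arc up to its endpoints. The degree $d(q)$ of a vertex is the number of edges ending at it (loops count twice); an interior point of an edge is regarded as a vertex of degree 2. For almost all $e\in S^2$ the linear function $\langle e,\cdot\rangle$ has only finitely many critical points along $\Gamma$; for such $e$, $\Gamma$ is subdivided so that all critical points are among its vertices. The up-degree $d^+(e,q)$ is the number of edges of $\Gamma$ with endpoint $q$ on which $\langle e,\cdot\rangle$ is greater than $\langle e,q\rangle$ (near $q$); the down-degree $d^-(e,q)$ is the number of edges with endpoint $q$ on which it is less. The double $\widetilde\Gamma$ of $\Gamma$ has the same vertices and two copies of each edge. A parameterization $\Gamma'$ of $\widetilde\Gamma$ is a mapping from a (not necessarily connected) compact 1-manifold without boundary which covers each edge of $\widetilde\Gamma$ exactly once; $d=d(q)$ points $q_1,\dots,q_d$ of $\Gamma'$ lie over $q$. $\mathrm{lmax}(e,q)$ and $\mathrm{lmin}(e,q)$ are the numbers of local maxima and local minima of $\langle e,\cdot\rangle$ along $\Gamma'$ among $q_1,\dots,q_d$, and $\mathrm{nlm}(e,q)=\frac12[\mathrm{lmax}(e,q)-\mathrm{lmin}(e,q)]$. *)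

(* Defs.v *)
From HB Require Import structures.
From mathcomp Require Import all_boot all_order all_algebra.
From mathcomp Require Import finmap.
From mathcomp Require Import all_classical all_reals all_analysis.
Set Implicit Arguments.
Unset Strict Implicit.
Unset Printing Implicit Defensive.
Import Order.TTheory GRing.Theory Num.Theory.
Import numFieldNormedType.Exports.
Local Open Scope classical_set_scope.
Local Open Scope ring_scope.

Definition dot (R : realType) (u v : 'rV[R]_3) : R :=
  \sum_(i < 3) u ord0 i * v ord0 i.

Definition unit_sphere (R : realType) : set 'rV[R]_3 :=
  [set e | dot e e = 1].

(* Lebesgue measure of R^3, carried by R * R * R where the library has product
   measures. *)
Definition lebesgue3 (R : realType) : set (R * R * R) -> \bar R :=
  ((@lebesgue_measure R \x @lebesgue_measure R) \x @lebesgue_measure R)%E.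

Definition vec3 (R : realType) (p : R * R * R) : 'rV[R]_3 :=
  \row_(i < 3) tnth [tuple p.1.1; p.1.2; p.2] i.

Definition solid_cone (R : realType) (A : set 'rV[R]_3) : set (R * R * R) :=
  [set p | exists t : R, exists e : 'rV[R]_3,
     [/\ 0 < t, t <= 1, A e & vec3 p = t *: e]].

(* "for almost all e in S^2".  The area of a subset A of the unit sphere is
   three times the volume of the solid cone {t e | 0 < t <= 1, e in A}, so A is
   null for the area measure iff this cone is Lebesgue null. *)
Definition ae_sphere (R : realType) (P : 'rV[R]_3 -> Prop) : Prop :=
  negligible (@lebesgue3 R)
    (solid_cone [set e | unit_sphere e /\ ~ P e]).

(* A finite multigraph (loops allowed) drawn in R^3.  Only the values of
   [arc a] on [0, 1] matter. *)
Record graph3 (R : realType) := Graph3 {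
  vertex : finType;
  edge : finType;
  source : edge -> vertex;
  target : edge -> vertex;
  pos : vertex -> 'rV[R]_3;
  arc : edge -> R -> 'rV[R]_3
}.

Arguments pos {R} g v.

Definition graph_support (R : realType) (G : graph3 R) : set 'rV[R]_3 :=
  [set q | (exists v, pos G v = q) \/
           (exists a : edge G, exists t : R, 0 <= t <= 1 /\ arc a t = q)].

(* C^2 up to the endpoints: the arc extends to a C^2 map on the whole line. *)
Definition regular_C2_arc (R : realType) (g : R -> 'rV[R]_3) : Prop :=
  exists h : R -> 'rV[R]_3,
    [/\ forall t, derivable h t 1,
        forall t, derivable (derive1 h) t 1,
        continuous (derive1n 2 h),
        forall t, 0 <= t <= 1 -> g t = h t &
        forall t, 0 <= t <= 1 -> derive1 h t != 0].

Definition embedded (R : realType) (G : graph3 R) : Prop :=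
  [/\ injective (pos G),
      forall (a b : edge G) (t s : R), 0 < t < 1 -> 0 < s < 1 ->
        arc a t = arc b s -> a = b /\ t = s &
      forall (a : edge G) (t : R) (v : vertex G), 0 < t < 1 ->
        arc a t <> pos G v].

(* The points at which a piecewise C^2 edge has a corner are taken to be
   vertices (of degree 2), so that every edge is regular and C^2. *)
Definition piecewise_C2_graph (R : realType) (G : graph3 R) : Prop :=
  [/\ forall a : edge G,
        [/\ arc a 0 = pos G (source a), arc a 1 = pos G (target a) &
            regular_C2_arc (arc a)],
      embedded G &
      connected (graph_support G)].

(* An edge end at q: an edge a, a parameter t with arc a t = q, and a direction
   (true: increasing parameter) in which the edge leaves q.  A loop has two ends
   at its vertex, and an interior point of an edge has two ends, i.e. it counts
   as a vertex of degree 2 at which the edge is subdivided. *)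
Definition edge_ends (R : realType) (G : graph3 R) (q : 'rV[R]_3) :
    set (edge G * R * bool) :=
  [set g | [/\ 0 <= g.1.2 <= 1, arc g.1.1 g.1.2 = q &
               if g.2 then g.1.2 < 1 else 0 < g.1.2]].

Definition along (R : realType) (G : graph3 R) (g : edge G * R * bool) (s : R) :
    'rV[R]_3 :=
  arc g.1.1 (if g.2 then g.1.2 + s else g.1.2 - s).

(* The number of elements; it is meaningful for finite sets only. *)
Definition ncard (T : choiceType) (A : set T) : nat := (#|` fset_set A |)%fset.

Arguments edge_ends {R} G q.

Definition degree (R : realType) (G : graph3 R) (q : 'rV[R]_3) : nat :=
  ncard (edge_ends G q).

Definition up_degree (R : realType) (G : graph3 R) (e q : 'rV[R]_3) : nat :=
  ncard [set g | edge_ends G q g /\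
                 \forall s \near 0^'+, dot e q < dot e (along g s)].

Definition down_degree (R : realType) (G : graph3 R) (e q : 'rV[R]_3) : nat :=
  ncard [set g | edge_ends G q g /\
                 \forall s \near 0^'+, dot e (along g s) < dot e q].

Definition double (R : realType) (G : graph3 R) : graph3 R :=
  @Graph3 R (vertex G) (edge G * bool)%type
    (fun b => source b.1) (fun b => target b.1) (pos G) (fun b => arc b.1).

Definition compact_1manifold (R : realType) (M : topologicalType) : Prop :=
  [/\ hausdorff_space M,
      compact [set: M] &
      forall m : M, exists phi : R -> M,
        [/\ continuous phi, injective phi,
            forall U : set R, open U -> open (phi @` U) &
            exists x, phi x = m]].

(* [f] is the composition of the parameterization M -> double G with the
   projection of the double to G in R^3.  The lift to the double is recorded by
   [sheet b], the inverse of the parameterization over the open edge b: the open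
   edges of the double are covered once each, homeomorphically, by pairwise
   disjoint open arcs of M, and all other points of M lie over vertices. *)
Definition double_parameterization (R : realType) (G : graph3 R)
    (M : topologicalType) (f : M -> 'rV[R]_3) : Prop :=
  [/\ compact_1manifold R M,
      continuous f,
      exists sheet : edge (double G) -> R -> M,
        [/\ forall b t, 0 < t < 1 -> {for t, continuous (sheet b)},
            forall b (U : set R), open U -> U `<=` [set t | 0 < t < 1] ->
              open (sheet b @` U),
            forall b c t s, 0 < t < 1 -> 0 < s < 1 ->
              sheet b t = sheet c s -> b = c /\ t = s,
            forall b t, 0 < t < 1 -> f (sheet b t) = arc b t &
            forall m, (exists b t, 0 < t < 1 /\ sheet b t = m) \/
                      (exists v : vertex (double G), f m = pos (double G) v)] &
      forall q, graph_support G q ->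
        ([set m | f m = q] #= `I_(degree G q))%card].

Definition lmax (R : realType) (M : topologicalType) (f : M -> 'rV[R]_3)
    (e q : 'rV[R]_3) : nat :=
  ncard [set m | f m = q /\ \forall m' \near m, dot e (f m') <= dot e (f m)].

Definition lmin (R : realType) (M : topologicalType) (f : M -> 'rV[R]_3)
    (e q : 'rV[R]_3) : nat :=
  ncard [set m | f m = q /\ \forall m' \near m, dot e (f m) <= dot e (f m')].

Definition nlm (R : realType) (M : topologicalType) (f : M -> 'rV[R]_3)
    (e q : 'rV[R]_3) : R :=
  2^-1 * ((lmax f e q)%:R - (lmin f e q)%:R).

(* Main.v *)
Require Import Defs.
From HB Require Import structures.
From mathcomp Require Import all_boot all_order all_algebra.
From mathcomp Require Import finmap zify ring lra.
From mathcomp Require Import all_classical all_reals all_analysis.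
From mathcomp Require Import measurable_realfun.
Set Implicit Arguments.
Unset Strict Implicit.
Unset Printing Implicit Defensive.
Import Order.TTheory GRing.Theory Num.Theory.
Import numFieldNormedType.Exports.
Import Defs.
Local Open Scope classical_set_scope.
Local Open Scope ring_scope.

(** Call a direction [e] noncritical when the height [dot e] has, along every
    edge, no point at which its first and second derivatives both vanish.

    For noncritical [e] the height is strictly monotone along each edge end by
    the second derivative test, so every edge end at [q] is either an up end or
    a down end ([edge_end_up_or_down]).  Let [m] be one of the [d] points of the
    1-manifold over [q].  A chart at [m] gives [m] two sides.  Close to [m] a
    side meets no point over a vertex, so by connectedness it stays in one
    sheet; there it is an injective path of reals, hence monotone, and it
    converges to a parameter lying over [q].  So each side runs along an end of
    the double at [q] ([point_sides]).  Different sides run along different ends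
    because [M] is Hausdorff and the chart is injective ([side_ends_inj]).
    There are [2 d] sides and [2 d] ends in the double, so sides and ends
    correspond bijectively.  Now [m] is a local maximum iff both of its sides are down, and
    a local minimum iff both are up ([local_max_sides]).  Each point contributes
    its number of down sides minus 1 to lmax - lmin, and summing over the points
    gives 2 d^- - d = d^- - d^+ ([count_both_sides]).

    Almost every direction is noncritical ([ae_noncritical]): this is the
    equidimensional case of Sard's theorem for the Gauss map on the unit normal
    bundle of an arc [h], and it has a direct proof.  Cut the parameter interval
    into [N] pieces.  If [e] is orthogonal to [h' t] and [h'' t], and [s] is the
    left end of the piece containing [t], the mean value theorem bounds
    [|dot e (h' s)|] by [1 / N] times the oscillation of [h''] at scale [1 / N].
    So [e] lies in one of about [N] bands of width o(1 / N), whose total volume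
    tends to 0 ([negligible_critical_cone]). *)

(** * Volume of thin bands *)

Lemma ge0_integral_le_cstM d (T : measurableType d) (R : realType)
    (mu : {measure set T -> \bar R}) (B : set T) (c : \bar R) (g : T -> \bar R) :
  measurable B -> measurable_fun [set: T] g -> (0 <= c)%E ->
  (forall x, (0 <= g x)%E) -> (forall x, B x -> (g x <= c)%E) ->
  (forall x, ~ B x -> g x = 0%E) ->
  (\int[mu]_x g x <= c * mu B)%E.
Proof.
move=> mB mg c0 g0 gc gB.
rewrite -(integral_cst mu mB).
rewrite [leRHS]integral_mkcond; apply: ge0_le_integral => //.
- by apply/(measurable_restrictT _ mB); exact: measurable_cst.
- move=> x _; rewrite patchE; case: ifPn => [|]; first by rewrite inE => /gc.
  by rewrite notin_setE => /gB ->.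
Qed.

Section product_section_bounds.
Context d1 d2 (T1 : measurableType d1) (T2 : measurableType d2) (R : realType).
Variables (m1 : {sigma_finite_measure set T1 -> \bar R})
  (m2 : {sigma_finite_measure set T2 -> \bar R}).

(** Two forms of Cavalieri's bound: slice along either factor. *)
Lemma product_measure_xsection_le (A : set (T1 * T2)) (B : set T1) (c : \bar R) :
  measurable A -> measurable B -> (0 <= c)%E ->
  (forall x, B x -> (m2 (xsection A x) <= c)%E) ->
  (forall p, A p -> B p.1) ->
  ((m1 \x m2) A <= c * m1 B)%E.
Proof.
move=> mA mB c0 Ac AB; apply: ge0_integral_le_cstM => //=.
  exact: measurable_fun_xsection.
move=> x nBx; rewrite (_ : xsection A x = set0) ?measure0//.
by rewrite -subset0 => y; rewrite /xsection/= inE => /AB.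
Qed.

Lemma product_measure_ysection_le (A : set (T1 * T2)) (B : set T2) (c : \bar R) :
  measurable A -> measurable B -> (0 <= c)%E ->
  (forall y, B y -> (m1 (ysection A y) <= c)%E) ->
  (forall p, A p -> B p.2) ->
  ((m1 \x m2) A <= c * m2 B)%E.
Proof.
move=> mA mB c0 Ac AB.
rewrite (product_measure_unique (m' := (m1 \x^ m2)%E))//; last first.
  by move=> *; exact: product_measure2E.
apply: ge0_integral_le_cstM => //=.
  by apply: measurable_fun_ysection => //; rewrite inE.
move=> x nBx; rewrite (_ : ysection A x = set0) ?measure0//.
by rewrite -subset0 => y; rewrite /ysection/= inE => /AB.
Qed.

End product_section_bounds.

Section band_measure.
Variable R : realType.
Local Notation mu := (@lebesgue_measure R).

Lemma lebesgue_band_le (A : set R) (a k d c : R) :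
  measurable A -> 0 < c -> c <= `|a| -> 0 <= d ->
  (forall x, A x -> `|a * x + k| <= d) -> (mu A <= (d / c *+ 2)%:E)%E.
Proof.
move=> mA c0 ca d0 Ad.
have a0 : 0 < `|a| by exact: lt_le_trans ca.
have da0 : 0 <= d / c by rewrite divr_ge0// ltW.
have mI : mu `[- k / a - d / c, - k / a + d / c] = (d / c *+ 2)%:E.
  rewrite lebesgue_measure_itv/= lte_fin; case: ltP => [_|].
    by rewrite -EFinB; congr _%:E; ring.
  by move=> h; rewrite (_ : d / c = 0) ?mul0rn//; lra.
rewrite -mI; apply: le_measure; rewrite ?inE// => x /Ad xd /=.
have an0 : a != 0 by rewrite -normr_gt0.
have e : `|a| * `|x - (- k / a)| <= d.
  by rewrite -normrM (_ : a * _ = a * x + k)//; field.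
rewrite in_itv/= -ler_distlC distrC ler_pdivlMr// mulrC.
by apply: le_trans e; rewrite ler_wpM2r.
Qed.
End band_measure.

Section sigma_finite_product.
Context d1 d2 (T1 : measurableType d1) (T2 : measurableType d2) (R : realType).
Variables (m1 : {sigma_finite_measure set T1 -> \bar R})
  (m2 : {sigma_finite_measure set T2 -> \bar R}).

(** A named copy of the product measure, so that its sigma-finiteness can be
    attached to it: iterated products need it to exchange integrals. *)
Definition sigma_finite_product : set (T1 * T2) -> \bar R := (m1 \x m2)%E.

HB.instance Definition _ := Measure.copy sigma_finite_product (m1 \x m2)%E.

Let sigma_finite_productT : sigma_finite setT sigma_finite_product.
Proof.
have [F FT Fm] := sigma_finiteT m1; have [G GT Gm] := sigma_finiteT m2.
exists (fun n => (\big[setU/set0]_(i < n.+1) F i) `*`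
                 (\big[setU/set0]_(i < n.+1) G i)).
  apply/esym; rewrite -subTset => -[x y] _.
  have [i _ Fx] : (\bigcup_i F i) x by rewrite -FT.
  have [j _ Gy] : (\bigcup_i G i) y by rewrite -GT.
  exists (maxn i j) => //; split => /=; rewrite -bigcup_mkord.
    by exists i => //=; rewrite ltnS leq_maxl.
  by exists j => //=; rewrite ltnS leq_maxr.
have fin d (T : measurableType d) (m : {measure set T -> \bar R})
    (H : (set T)^nat) n :
    (forall i, measurable (H i) /\ (m (H i) < +oo)%E) ->
    measurable (\big[setU/set0]_(i < n) H i) /\
    m (\big[setU/set0]_(i < n) H i) \is a fin_num.
  move=> Hm; split; first by apply: bigsetU_measurable => i _; case: (Hm i).
  rewrite ge0_fin_numE//; apply: (le_lt_trans (Boole_inequality _ _)).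
    by move=> i _; case: (Hm i).
  by apply: lte_sum_pinfty => i _; case: (Hm i).
move=> n; have [mF fF] := fin _ _ _ F n.+1 Fm.
have [mG fG] := fin _ _ _ G n.+1 Gm.
split; first exact: measurableX.
by rewrite /sigma_finite_product product_measure1E// ltey_eq fin_numM.
Qed.

HB.instance Definition _ := @Measure_isSigmaFinite.Build _ _ _
  sigma_finite_product sigma_finite_productT.

End sigma_finite_product.

Section bands_in_space.
Variable R : realType.
Local Notation mu := (@lebesgue_measure R).
Local Notation RM := (measurableTypeR R).
Local Notation unit_itv := [set x : RM | (`|x| <= 1)%R].

Definition band3 (v : 'rV[R]_3) (d : R) : set (R * R * R)%type :=
  [set p | [/\ `|p.1.1| <= 1, `|p.1.2| <= 1, `|p.2| <= 1 &
               `|dot (vec3 p) v| <= d]].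

Lemma measurable_abs_le d (T : measurableType d) (g : T -> RM) (c : R) :
  measurable_fun setT g -> measurable [set x | `|g x| <= c].
Proof.
move=> mg; rewrite (_ : mkset _ = g @^-1` `[- c, c]).
  by rewrite -[X in measurable X]setTI; apply: mg => //; exact: measurable_itv.
by apply/seteqP; split => x /=; rewrite in_itv/= ler_norml.
Qed.

Lemma lebesgue_unit_itv : mu unit_itv = 2%:E.
Proof.
rewrite (_ : mkset _ = `[-1, 1]%classic).
  rewrite lebesgue_measure_itv/= lte_fin (lt_trans (ltrN10 R) ltr01) -EFinB.
  by congr _%:E; ring.
by apply/seteqP; split => x /=; rewrite in_itv/= ler_norml.
Qed.

Lemma measurable_unit_itv : measurable unit_itv.
Proof. exact: (@measurable_abs_le _ _ id). Qed.

(** Slice parallel to a coordinate axis whose coefficient is large: each slice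
    is then an interval of length at most [2 d / c]. *)
Lemma lebesgue2_band_le (A : set (RM * RM)%type) (a b k d c : R) :
  measurable A -> 0 < c -> c <= `|a| \/ c <= `|b| -> 0 <= d ->
  (forall p, A p -> [/\ `|p.1| <= 1, `|p.2| <= 1 &
     `|a * p.1 + b * p.2 + k| <= d]) ->
  ((mu \x mu) A <= (d / c * 4)%:E)%E.
Proof.
move=> mA c0 cab d0 Ad.
have dc0 : 0 <= d / c by rewrite divr_ge0// ltW.
have -> : (d / c * 4)%:E = ((d / c *+ 2)%:E * mu unit_itv)%E.
  by rewrite lebesgue_unit_itv -EFinM; congr _%:E; ring.
have mI := measurable_unit_itv.
have [ca|cb] := cab.
- apply: product_measure_ysection_le => //; first by rewrite lee_fin mulrn_wge0.
    move=> y y1; apply: (lebesgue_band_le (a := a) (k := b * y + k)) => //.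
      exact: measurable_ysection.
    by move=> x; rewrite /ysection/= inE => /Ad[_ _]/=; rewrite addrA.
  by move=> p /Ad[].
- apply: product_measure_xsection_le => //; first by rewrite lee_fin mulrn_wge0.
    move=> x x1; apply: (lebesgue_band_le (a := b) (k := a * x + k)) => //.
      exact: measurable_xsection.
    by move=> y; rewrite /xsection/= inE => /Ad[_ _]/=; rewrite addrCA addrA.
  by move=> p /Ad[].
Qed.

Lemma dot_vec3 (p : R * R * R) (v : 'rV[R]_3) :
  dot (vec3 p) v = v ord0 (inord 0) * p.1.1 + v ord0 (inord 1) * p.1.2
    + v ord0 (inord 2) * p.2.
Proof.
rewrite /dot !big_ord_recr big_ord0/= add0r !mxE/=.
rewrite -!(mulrC (v _ _)).
by congr (v _ _ * _ + v _ _ * _ + v _ _ * _); apply/val_inj; rewrite /= inordK.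
Qed.

Lemma measurable_band3 v d : measurable (band3 v d : set (RM * RM * RM)%type).
Proof.
have m11 : measurable_fun setT (fun p : (RM * RM * RM)%type => p.1.1).
  exact: (measurableT_comp measurable_fst measurable_fst).
have m12 : measurable_fun setT (fun p : (RM * RM * RM)%type => p.1.2).
  exact: (measurableT_comp measurable_snd measurable_fst).
have m2 : measurable_fun setT (fun p : (RM * RM * RM)%type => p.2).
  exact: measurable_snd.
have -> : band3 v d = [set p | `|p.1.1| <= 1] `&` [set p | `|p.1.2| <= 1] `&`
    [set p | `|p.2| <= 1] `&` [set p | `|dot (vec3 p) v| <= d].
  by apply/seteqP; split => [p [? ? ? ?]//|p [[[]]]].
apply: measurableI; first apply: measurableI; first apply: measurableI.
- exact: (measurable_abs_le _ m11).
- exact: (measurable_abs_le _ m12).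
- exact: (measurable_abs_le _ m2).
apply: (@measurable_abs_le _ (RM * RM * RM)%type (fun p => dot (vec3 p) v)).
under eq_fun do rewrite dot_vec3.
by do ![apply: measurable_funD => //]; apply: measurable_funM => //;
  exact: measurable_cst.
Qed.

Lemma exists_coord_ge (v : 'rV[R]_3) (c : R) :
  0 < c -> c <= `|v| -> exists i, c <= `|v ord0 i|.
Proof.
move=> c0; rewrite [X in c <= X -> _]mx_normrE => cv.
apply: contrapT => /forallNP vc; move: cv; rewrite leNgt => /negP; apply.
apply: bigmax_lt => // -[j i] _ /=.
by rewrite (ord1 j) ltNge; apply/negP; exact: vc.
Qed.

Lemma lebesgue3_ysection_le (A : set (RM * RM * RM)%type) (B : set RM)
    (c : \bar R) :
  measurable A -> measurable B -> (0 <= c)%E ->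
  (forall z, B z -> ((mu \x mu) (ysection A z) <= c)%E) ->
  (forall p, A p -> B p.2) ->
  (lebesgue3 A <= c * mu B)%E.
Proof.
move=> mA mB c0 AB BB.
exact: (product_measure_ysection_le (m1 := sigma_finite_product mu mu)).
Qed.

Lemma lebesgue3_xsection_le (A : set (RM * RM * RM)%type)
    (B : set (RM * RM)%type) (c : \bar R) :
  measurable A -> measurable B -> (0 <= c)%E ->
  (forall p, B p -> (mu (xsection A p) <= c)%E) ->
  (forall p, A p -> B p.1) ->
  (lebesgue3 A <= c * (mu \x mu) B)%E.
Proof.
move=> mA mB c0 AB BB.
exact: (product_measure_xsection_le (sigma_finite_product mu mu)).
Qed.

Lemma lebesgue3_band_le (v : 'rV[R]_3) (d c : R) :
  0 < c -> c <= `|v| -> 0 <= d ->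
  (lebesgue3 (band3 v d) <= (d / c * 8)%:E)%E.
Proof.
move=> c0 cv d0.
have [i ci] := exists_coord_ge c0 cv.
have dc0 : 0 <= d / c by rewrite divr_ge0// ltW.
have mI := measurable_unit_itv.
have mB := measurable_band3 v d.
have [i01|i2] : (c <= `|v ord0 (inord 0)| \/ c <= `|v ord0 (inord 1)|) \/
    c <= `|v ord0 (inord 2)|.
  by case: i ci => [[|[|[|//]]] i] ci; [left; left|left; right|right];
   move: ci; congr (_ <= `|v _ _|); apply/val_inj; rewrite /= inordK.
- have -> : (d / c * 8)%:E = ((d / c * 4)%:E * mu unit_itv)%E.
    by rewrite lebesgue_unit_itv -EFinM; congr _%:E; ring.
  apply: (lebesgue3_ysection_le mB mI).
    - by rewrite lee_fin mulr_ge0.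
    - move=> y y1.
      apply: (lebesgue2_band_le _ c0 i01 d0 (k := v ord0 (inord 2) * y)).
        exact: measurable_ysection.
      by move=> p; rewrite /ysection/= inE => -[]/= ? ? ?; rewrite dot_vec3.
    - by move=> p [].
- have sq : (mu \x mu)%E (unit_itv `*` unit_itv) = 4%:E.
    transitivity (mu unit_itv * mu unit_itv)%E; first exact: product_measure1E.
    by rewrite lebesgue_unit_itv -EFinM; congr _%:E; ring.
  have -> : (d / c * 8)%:E =
      ((d / c *+ 2)%:E * (mu \x mu)%E (unit_itv `*` unit_itv))%E.
    by rewrite sq -EFinM; congr _%:E; ring.
  apply: (lebesgue3_xsection_le mB (measurableX mI mI)).
  + by rewrite lee_fin mulrn_wge0.
  + move=> x x1; apply: (lebesgue_band_le _ c0 i2 d0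
      (k := v ord0 (inord 0) * x.1 + v ord0 (inord 1) * x.2)).
      exact: measurable_xsection.
    by move=> y; rewrite /xsection/= inE => -[]/= ? ? ?; rewrite dot_vec3 addrC.
  + by move=> p [].
Qed.

(** Intersect covers of measure [1 / n]. *)
Lemma negligible_of_small d (T : measurableType d) (m : {measure set T -> \bar R})
    (A : set T) :
  (forall e : R, 0 < e ->
    exists B, [/\ measurable B, A `<=` B & (m B <= e%:E)%E]) ->
  m.-negligible A.
Proof.
move=> h.
have /choice[B hB] : forall n, exists B,
    [/\ measurable B, A `<=` B & (m B <= (n.+1%:R^-1)%:E)%E].
  by move=> n; apply: h; rewrite invr_gt0.
exists (\bigcap_n B n); split.
- by apply: bigcapT_measurable => n; have [] := hB n.
- apply/eqP; rewrite eq_le measure_ge0 andbT; apply/lee_addgt0Pr => e e0.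
  rewrite add0e.
  have [n ne] : exists n : nat, n.+1%:R^-1 < e.
    have /cvgrPdist_lt/(_ e e0)[n _ /(_ n (leqnn _))] := @cvg_harmonic R.
    by rewrite sub0r normrN ger0_norm ?invr_ge0// => ?; exists n.
  have [mB _ hn] := hB n.
  apply: (@le_trans _ _ (m (B n))).
    apply: le_measure; rewrite ?inE//; last exact: bigcap_inf.
    by apply: bigcapT_measurable => k; have [] := hB k.
  by apply: (le_trans hn); rewrite lee_fin ltW.
- by apply: sub_bigcap => n _; have [] := hB n.
Qed.

End bands_in_space.

Lemma negligible_finite_bigcup d (T : measurableType d) (R : realType)
    (mu : {measure set T -> \bar R}) (I : finType) (F : I -> set T) :
  (forall i, mu.-negligible (F i)) -> mu.-negligible (\bigcup_i F i).
Proof.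
move=> nF; rewrite (_ : \bigcup_i F i = \big[setU/set0]_(i : I) F i).
  by apply: big_ind => [||i _];
    [exact: negligible_set0|exact: negligibleU|exact: nF].
rewrite -bigcup_seq; apply: eq_bigcupl; split => i //= _.
exact: mem_index_enum.
Qed.

(** * The height function of an arc *)

Section dot.
Variable R : realType.

Lemma dotBr (u v w : 'rV[R]_3) : dot u (v - w) = dot u v - dot u w.
Proof.
by rewrite /dot -sumrB; apply: eq_bigr => i _; rewrite !mxE mulrBr.
Qed.

Lemma dotNl (u v : 'rV[R]_3) : dot (- u) v = - dot u v.
Proof. by rewrite /dot -sumrN; apply: eq_bigr => i _; rewrite mxE mulNr. Qed.

Lemma dotZl (a : R) (u v : 'rV[R]_3) : dot (a *: u) v = a * dot u v.
Proof. by rewrite /dot mulr_sumr; apply: eq_bigr => i _; rewrite mxE mulrA. Qed.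

Lemma dot_le_norm (u v : 'rV[R]_3) (c : R) :
  (forall i, `|u ord0 i| <= 1) -> `|v| <= c -> `|dot u v| <= 3 * c.
Proof.
move=> u1 vc; apply: (le_trans (ler_norm_sum _ _ _)).
have -> : 3 * c = \sum_(i < 3) c by rewrite sumr_const card_ord mulr_natl.
apply: ler_sum => i _; rewrite normrM -[leRHS]mul1r ler_pM//.
apply: le_trans vc; rewrite [leRHS]mx_normrE.
exact: (le_bigmax _ (fun ij => `|v ij.1 ij.2|) (ord0, i)).
Qed.

Lemma is_derive_dot (h : R -> 'rV[R]_3) (e : 'rV[R]_3) (t : R) :
  derivable h t 1 ->
  is_derive t 1 (fun s => dot e (h s)) (dot e (derive1 h t)).
Proof.
move=> ht; have hi i : is_derive t 1 (fun s => h s ord0 i) (derive1 h t ord0 i).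
  rewrite derive1E derive_mx// mxE.
  by apply: DeriveDef => //; exact: ((derivable_mxP _ _ _).1 ht).
have := is_derive_sum (fun i => is_deriveZ (e ord0 i) (hi i)).
rewrite /dot/=; congr is_derive.
by apply/funext => s; rewrite fct_sumE.
Qed.

End dot.

Section second_derivative_test.
Variable R : realType.
Implicit Types psi dpsi : R -> R.

Lemma near_right_gt_of_derive_gt0 psi (t l : R) :
  is_derive t 1 psi l -> 0 < l -> \forall s \near 0^'+, psi t < psi (t + s).
Proof.
move=> [dp pl] l0.
have : (fun h => h^-1 *: (psi (h *: 1 + t) - psi t)) @ 0^' --> l.
  by rewrite -pl; exact: dp.
move=> /cvg_dnbhs_at_right /(cvgr_gt l)/(_ _ l0) H.
near=> s.
have s0 : 0 < s by near: s; exact: nbhs_right_gt.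
have : 0 < s^-1 *: (psi (s *: 1 + t) - psi t) by near: s.
by rewrite /GRing.scale/= pmulr_rgt0 ?invr_gt0// mulr1 subr_gt0 addrC.
Unshelve. all: by end_near. Qed.

Lemma near_right_gt_of_derive2_gt0 psi dpsi (l : R) :
  (forall s : R, is_derive s 1 psi (dpsi s)) -> dpsi 0 = 0 ->
  is_derive (0 : R) 1 dpsi l -> 0 < l -> \forall s \near 0^'+, psi 0 < psi s.
Proof.
move=> dp p0 d2 l0.
have := near_right_gt_of_derive_gt0 d2 l0; rewrite p0 => H.
have {H}[d /= d0 Hd] : \forall s \near 0^'+, 0 < dpsi s.
  by apply: filterS H => s; rewrite add0r.
exists d => //= s sd s0.
have cpsi : {within `[0, s], continuous psi}.
  apply: continuous_subspaceT => x; apply: differentiable_continuous.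
  by apply/derivable1_diffP; case: (dp x).
have [c] := MVT s0 (fun x _ => dp x) cpsi.
rewrite in_itv/= => /andP[c0 cs] e.
rewrite -subr_gt0 e mulr_gt0 ?subr_gt0//; apply: Hd => //=.
move: sd; rewrite /= !sub0r !normrN !gtr0_norm//; exact: lt_trans.
Qed.

(** Second derivative test: apply the two lemmas above to [psi] or to
    [- psi]. *)
Lemma near_right_strict_sign psi dpsi (l : R) :
  (forall s : R, is_derive s 1 psi (dpsi s)) -> is_derive (0 : R) 1 dpsi l ->
  ~ (dpsi 0 = 0 /\ l = 0) ->
  (\forall s \near 0^'+, psi 0 < psi s) \/ (\forall s \near 0^'+, psi s < psi 0).
Proof.
have pos (f df : R -> R) (m : R) :
    (forall s : R, is_derive s 1 f (df s)) -> is_derive (0 : R) 1 df m ->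
    0 < df 0 \/ (df 0 = 0 /\ 0 < m) -> \forall s \near 0^'+, f 0 < f s.
  move=> fd dfd [f0|[f0 m0]].
    have := near_right_gt_of_derive_gt0 (fd 0) f0.
    by apply: filterS => s; rewrite add0r.
  exact: (near_right_gt_of_derive2_gt0 fd f0 dfd).
move=> dp d2 nz.
have [h|h] : (0 < dpsi 0 \/ (dpsi 0 = 0 /\ 0 < l)) \/
             (0 < - dpsi 0 \/ (- dpsi 0 = 0 /\ 0 < - l)).
  rewrite !oppr_gt0; case: (ltgtP (dpsi 0) 0) => [||d0];
    [by right; left|by left; left|].
  rewrite d0 oppr0; case: (ltgtP l 0) => [||l0]; [by right; right|by left; right|].
  by exfalso; apply: nz.
- by left; apply: pos h.
- right; have : \forall s \near 0^'+, (- psi) 0 < (- psi) s.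
    by apply: (pos (- psi) (- dpsi)) h => [s|]; exact: is_deriveN.
  by apply: filterS => s; rewrite ltrN2.
Qed.

End second_derivative_test.

(** * Almost every direction is noncritical for an arc *)

Section critical_directions.
Variable R : realType.

Lemma unif_continuous_unit_itv (V : normedModType R) (H : R -> V) (eps : R) :
  continuous H -> 0 < eps ->
  exists2 d, 0 < d & forall s t : R, 0 <= s <= 1 -> 0 <= t <= 1 ->
    `|s - t| < d -> `|H s - H t| < eps.
Proof.
move=> cH eps0.
have /compact_near_coveringP K := @segment_compact R 0 1.
have : \forall d \near (0:R)^'+, `[0, 1] `<=`
    [set s : R | forall t, `|s - t| < d -> `|H s - H t| < eps].
  (* Near [s], both [s'] and any [t] within [d < r / 2] of it are in the ball
     on which [H] stays within [eps / 2] of [H s]. *)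
  apply: K => s _.
  have /cvgrPdist_lt/(_ (eps / 2)) := cH s.
  rewrite divr_gt0// => /(_ isT)/nbhs_ballP[r /= r0 rH].
  exists (ball s (r / 2), [set d | d < r / 2]).
    split => /=; first by apply: nbhsx_ballx; rewrite divr_gt0.
    by apply: nbhs_right_lt; rewrite divr_gt0.
  move=> [s' d] /= [ss' dr] t s't.
  have -> : H s' - H t = (H s - H t) - (H s - H s').
    by rewrite opprB [RHS]addrC subrKA.
  rewrite (splitr eps) (le_lt_trans (ler_normB _ _))// ltrD//; apply: rH.
    rewrite /ball/= (_ : s - t = (s - s') + (s' - t)); last by ring.
    rewrite (splitr r) (le_lt_trans (ler_normD _ _))// ltrD//.
    exact: lt_trans s't dr.
  by apply: lt_trans ss' _; lra.
move=> [r /= r0 rP]; exists (r / 2); first by rewrite divr_gt0.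
move=> s t s01 t01 st; apply: (rP (r / 2)) => //=.
- by rewrite sub0r normrN gtr0_norm ?divr_gt0// ltr_pdivrMr// ltr_pMr// ltr1n.
- by rewrite divr_gt0.
Qed.

Lemma derivable_continuous (V : normedModType R) (h : R -> V) :
  (forall t, derivable h t 1) -> continuous h.
Proof.
by move=> dh t; apply/differentiable_continuous/derivable1_diffP.
Qed.

(** The vectors of the unit cube for which the height along [h] has a degenerate
    critical point.  It is scale invariant inside the cube, so it contains the
    solid cone over the degenerate directions of the sphere. *)
Definition critical_cone (h : R -> 'rV[R]_3) : set (R * R * R) :=
  [set p | (forall i, `|vec3 p ord0 i| <= 1) /\ exists2 t, 0 <= t <= 1 &
     dot (vec3 p) (derive1 h t) = 0 /\ dot (vec3 p) (derive1 (derive1 h) t) = 0].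

(** The mean value theorem for [dot p (h' _)] between the node [s = k / N] and a
    degenerate critical point [t] with [k <= t N < k + 1]: the derivative at the
    intermediate point [x] is [dot p (h'' x - h'' t)], hence at most
    [3 eta]. *)
Lemma critical_cone_band (h : R -> 'rV[R]_3) (eta : R) (N : nat) :
  (forall t, derivable h t 1) -> (forall t, derivable (derive1 h) t 1) ->
  (0 < N)%N ->
  (forall s t : R, 0 <= s <= 1 -> 0 <= t <= 1 -> `|s - t| < N%:R^-1 ->
    `|derive1 (derive1 h) s - derive1 (derive1 h) t| < eta) ->
  critical_cone h `<=` \bigcup_(k < N.+1)
    band3 (derive1 h (k%:R / N%:R)) (3 * eta / N%:R).
Proof.
move=> dh d2h N0 hN p [p1 [t t01 [e1 e2]]].
have N0' : 0 < N%:R :> R by rewrite ltr0n.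
have /andP[t0 tle1] := t01.
have tN0 : 0 <= t * N%:R by rewrite mulr_ge0// ltW.
have /andP[kt tk] := truncn_itv tN0.
set k := Num.trunc _ in kt tk; pose s : R := k%:R / N%:R.
have st : s <= t by rewrite ler_pdivrMr.
have s0 : 0 <= s by rewrite divr_ge0// ltW.
have ts : t - s < N%:R^-1.
  rewrite ltrBlDl -[X in _ + X]mul1r -mulrDl ltr_pdivlMr//.
  by rewrite natr1.
exists k => /=.
  rewrite ltnS -(ler_nat R) (le_trans kt)// ler_piMl// ltW//.
have pi n (n3 : (n < 3)%N) : `|[:: p.1.1; p.1.2; p.2]`_n| <= 1.
  by have := p1 (Ordinal n3); rewrite mxE (tnth_nth 0).
split; [exact: (pi 0%N)|exact: (pi 1%N)|exact: (pi 2%N)|].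
have ds (x : R) : is_derive x 1 (fun s => dot (vec3 p) (derive1 h s))
    (dot (vec3 p) (derive1 (derive1 h) x)) by exact: is_derive_dot.
have cds : {within `[s, t], continuous (fun s => dot (vec3 p) (derive1 h s))}.
  apply/continuous_subspaceT/derivable_continuous => x.
  by case: (ds x).
have [x /itvP xst] := MVT_segment st (fun x _ => ds x) cds.
rewrite e1 sub0r => ex.
rewrite -normrN ex normrM (ger0_norm (_ : 0 <= t - s)) ?subr_ge0//.
apply: ler_pM => //; [by rewrite subr_ge0| |exact: ltW].
(* A derivative that vanishes at [t] equals its own increment. *)
have subE a b : dot (vec3 p) b = 0 -> dot (vec3 p) a = dot (vec3 p) (a - b).
  by move=> b0; rewrite dotBr b0 subr0.
rewrite (subE _ _ e2).
apply: dot_le_norm => //; apply/ltW/hN => //.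
  by rewrite (le_trans s0) ?xst//= (le_trans _ tle1)// xst.
rewrite distrC ger0_norm ?subr_ge0 ?xst// (le_lt_trans _ ts)//.
by rewrite lerD2l lerN2 xst.
Qed.

Lemma derive1_norm_bounded_below (h : R -> 'rV[R]_3) :
  (forall t, derivable (derive1 h) t 1) ->
  (forall t, 0 <= t <= 1 -> derive1 h t != 0) ->
  exists2 c, 0 < c & forall t, 0 <= t <= 1 -> c <= `|derive1 h t|.
Proof.
move=> d2h h0.
have cn : {within `[0, 1], continuous (fun t => `|derive1 h t|)}.
  apply: continuous_subspaceT => t.
  by apply: cvg_norm; exact: (derivable_continuous d2h).
have [c c01 hc] := EVT_min ler01 cn.
exists `|derive1 h c|; first by rewrite normr_gt0 h0//; move: c01; rewrite in_itv.
by move=> t t01; apply: hc; rewrite in_itv.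
Qed.

(** The [N + 1] bands have total volume at most [(N + 1) * 24 eta / (N c)], where
    [c] bounds the speed from below.  This is at most [48 eta / c], and [eta] is
    arbitrary. *)
Lemma negligible_critical_cone (h : R -> 'rV[R]_3) :
  (forall t, derivable h t 1) -> (forall t, derivable (derive1 h) t 1) ->
  continuous (derive1 (derive1 h)) ->
  (forall t, 0 <= t <= 1 -> derive1 h t != 0) ->
  negligible (@lebesgue3 R) (critical_cone h).
Proof.
move=> dh d2h c2h h0.
have [c c0 hc] := derive1_norm_bounded_below d2h h0.
apply: (@negligible_of_small R _ _
  (product_measure1 (sigma_finite_product lebesgue_measure lebesgue_measure)
    (@lebesgue_measure R))).
move=> e e0; pose eta := e * c / 48.
have eta0 : 0 < eta by rewrite divr_gt0// mulr_gt0.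
have [d d0 hd] := unif_continuous_unit_itv c2h eta0.
have [n nd] : exists n : nat, n.+1%:R^-1 < d.
  have /cvgrPdist_lt/(_ d d0)[n _ /(_ n (leqnn _))] := @cvg_harmonic R.
  by rewrite sub0r normrN ger0_norm ?invr_ge0// => ?; exists n.
pose B k : set (measurableTypeR R * measurableTypeR R * measurableTypeR R)%type :=
  band3 (derive1 h (k%:R / n.+1%:R)) (3 * eta / n.+1%:R).
have mB k : measurable (B k) by exact: measurable_band3.
exists (\big[setU/set0]_(k < n.+2) B k); split.
- by apply: bigsetU_measurable => k _.
- rewrite -bigcup_mkord; apply: critical_cone_band => // s t s01 t01 st.
  by apply: hd => //; exact: lt_trans nd.
apply: (le_trans (Boole_inequality _ _)) => //.
have Bk (k : 'I_n.+2) : (lebesgue3 (B k) <= (3 * eta / n.+1%:R / c * 8)%:E)%E.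
  apply: lebesgue3_band_le => //; first apply: hc.
    rewrite divr_ge0//= ler_pdivrMr// mul1r ler_nat.
    by rewrite -ltnS.
  by rewrite !mulr_ge0// ltW.
apply: (@le_trans _ _ (\sum_(k < n.+2) (3 * eta / n.+1%:R / c * 8)%:E)%E).
  by apply: lee_sum => k _; exact: Bk.
rewrite sumEFin lee_fin sumr_const card_ord -[leLHS]mulr_natr /eta -[n.+2%:R]natr1.
have N1 : 1 <= n.+1%:R :> R by rewrite ler1n.
set N := n.+1%:R in N1 *.
have -> : 3 * (e * c / 48) / N / c * 8 * (N + 1) = e * ((N + 1) / (2 * N)).
  by field; rewrite !gt_eqF//; lra.
rewrite ger_pMr// ler_pdivrMr ?mulr_gt0//; lra.
Qed.

End critical_directions.

(** * One-sided germs of real paths *)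

Section germ.
Variable R : realType.
Implicit Types gam u : R -> R.

Definition germ_param (t : R) (dir : bool) (s : R) := if dir then t + s else t - s.

(** [u] behaves at the right of 0 like the distance to an end point: it is
    positive, tends to 0, and near 0 takes all small positive values.  The last
    condition makes any two germs share a value arbitrarily close to 0. *)
Definition right_germ (d : R) u :=
  [/\ forall s, 0 < s < d -> 0 < u s,
      u s @[s --> 0^'+] --> (0 : R) &
      forall s t, 0 < s < d -> 0 < t < u s -> exists2 s', 0 < s' < s & u s' = t].

(** The limit at 0 is the infimum; intermediate values come from the IVT. *)
Lemma increasing_right_germ gam (d : R) :
  0 < d ->
  (forall s, 0 < s < d -> 0 < gam s < 1) ->
  (forall s, 0 < s < d -> {for s, continuous gam}) ->
  (forall s t, 0 < s < d -> 0 < t < d -> s < t -> gam s < gam t) ->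
  exists2 t0, 0 <= t0 < 1 & right_germ d (fun s => gam s - t0).
Proof.
move=> d0 g01 cg ig.
pose A := gam @` `]0, d[; pose t0 := inf A.
have A0 : A !=set0.
  by exists (gam (d / 2)), (d / 2) => //=; rewrite in_itv/=; apply/andP; lra.
have Alb : lbound A 0.
  by move=> _ [s /= + <-]; rewrite in_itv/= => /g01/andP[/ltW].
have hA : has_inf A by split => //; exists 0.
have t0g s : 0 < s < d -> t0 < gam s.
  move=> sd; apply: (@le_lt_trans _ _ (gam (s / 2))); last by apply: ig; lra.
  apply: ge_inf; first by exists 0.
  by exists (s / 2) => //=; rewrite in_itv/=; apply/andP; lra.
exists t0.
  apply/andP; split; first exact: lb_le_inf.
  have dd : 0 < d / 2 < d by apply/andP; lra.
  by have /andP[_] := g01 _ dd; apply: lt_trans; exact: t0g.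
split.
- by move=> s sd; rewrite subr_gt0 t0g.
- have lim : gam s @[s --> 0^'+] --> t0.
    apply: (@nondecreasing_at_right_cvgr _ gam 0 (BLeft d)) => //.
    + move=> x y; rewrite !in_itv/= => xd yd.
      by rewrite le_eqVlt => /predU1P[->//|xy]; apply/ltW/ig.
    + by exists 0.
  rewrite [X in _ --> X](_ : 0 = t0 - t0); last by rewrite subrr.
  by apply: (cvgB lim); exact: cvg_cst.
- move=> s t sd /andP[t_gt0 ts].
  have [_ [s1 + <-] s1t] := inf_adherent t_gt0 hA.
  rewrite /= in_itv/= -/t0 => s1d; rewrite -/t0 in s1t.
  have s1s : s1 < s.
    rewrite ltNge; apply/negP => ss1.
    have : gam s <= gam s1.
      by move: ss1; rewrite le_eqVlt => /predU1P[->//|?]; apply/ltW/ig.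
    by lra.
  have cs : {within `[s1, s], continuous gam}.
    apply: continuous_in_subspaceT => x; rewrite inE/= in_itv/= => xs.
    by apply: cg; lra.
  have [|s' /itvP s's gs'] := @IVT _ gam s1 s (t0 + t) (ltW s1s) cs.
    have h := ltW (ig _ _ s1d sd s1s).
    by rewrite minEle maxEle h; apply/andP; split; lra.
  exists s'; last by rewrite gs'; lra.
  have s'n : s' != s by apply: contra_eq_neq gs' => ->; rewrite gt_eqF//; lra.
  have s'lt : s' < s by rewrite lt_neqAle s'n s's.
  have s1s' : s1 <= s' by rewrite s's.
  by apply/andP; split => //; lra.
Qed.

(** A continuous injective path is monotone.  A decreasing one is handled through
    [1 - gam]; [dir] records which case occurs. *)
Lemma injective_right_germ gam (d : R) :
  0 < d ->
  (forall s, 0 < s < d -> 0 < gam s < 1) ->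
  (forall s, 0 < s < d -> {for s, continuous gam}) ->
  (forall s t, 0 < s < d -> 0 < t < d -> gam s = gam t -> s = t) ->
  exists t0 dir u, [/\ 0 <= t0 <= 1, (if dir then t0 < 1 else 0 < t0),
    forall s, gam s = germ_param t0 dir (u s) & right_germ d u].
Proof.
move=> d0 g01 cg ig.
have cw : {within [set` `]0, d[], continuous gam}.
  by apply: continuous_in_subspaceT => x; rewrite inE/= in_itv/= => /cg.
have iw : {in `]0, d[ &, injective gam}.
  by move=> x y; rewrite !in_itv/=; exact: ig.
have [inc|dec] := itv_continuous_inj_mono cw iw.
- have [|t0 /andP[t00 t01] hu] := increasing_right_germ d0 g01 cg.
    by move=> s t sd td st; apply: inc => //; rewrite in_itv.
  exists t0, true, (fun s => gam s - t0); split => //; rewrite ?t00 ?ltW//.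
  by move=> s; rewrite /germ_param subrKC.
- have [| | |t0 /andP[t00 t01] hu] :=
    @increasing_right_germ (fun s => 1 - gam s) d d0.
  + by move=> s /g01; lra.
  + by move=> s sd; apply: cvgB; [exact: cvg_cst|exact: cg].
  + move=> s t sd td st; rewrite ltrD2l ltrN2.
    by apply: dec => //; rewrite in_itv.
  exists (1 - t0), false, (fun s => 1 - gam s - t0); split => //.
  + by apply/andP; lra.
  + by rewrite subr_gt0.
  + by move=> s; rewrite /germ_param; lra.
Qed.

End germ.

(** * Paths in the sheets over the open edges *)

Section sheets.
Variables (R : realType) (B : Type) (M : topologicalType) (sheet : B -> R -> M).
Hypothesis sheet_open : forall b (U : set R), open U ->
  U `<=` [set t | 0 < t < 1] -> open (sheet b @` U).
Hypothesis sheet_inj : forall b c t s, 0 < t < 1 -> 0 < s < 1 ->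
  sheet b t = sheet c s -> b = c /\ t = s.

Lemma open_unit_itv : open [set t : R | 0 < t < 1].
Proof.
rewrite (_ : mkset _ = `]0, 1[%classic); first exact: interval_open.
by apply/seteqP; split => t /=; rewrite in_itv.
Qed.

(** The open sheets are disjoint, so a connected path stays in one of them. *)
Lemma path_in_one_sheet (p : R -> M) (d : R) :
  0 < d -> continuous p ->
  (forall s, 0 < s < d -> exists b t, 0 < t < 1 /\ sheet b t = p s) ->
  exists b, forall s, 0 < s < d -> exists t, 0 < t < 1 /\ sheet b t = p s.
Proof.
move=> d0 cp hp.
have d2 : 0 < d / 2 < d by apply/andP; lra.
have [b [t2 [t2_01 pd2]]] := hp _ d2; exists b.
pose O c := sheet c @` [set t | 0 < t < 1].
have oO c : open (O c) by apply: sheet_open => //; exact: open_unit_itv.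
have conn : connected `]0, d[.
  by apply/connected_intervalP; exact: interval_is_interval.
have/(_ _ _ _)/seteqP[] := conn (`]0, d[ `&` p @^-1` O b).
- exists (d / 2); split => /=; first by rewrite in_itv.
  by exists t2.
- exists (p @^-1` O b) => //.
  by apply: open_comp => // x _; exact: cp.
- exists (~` (p @^-1` (\bigcup_(c in [set c | c <> b]) O c))).
    rewrite closedC; apply: open_comp => [x _|]; first exact: cp.
    by apply: bigcup_open.
  apply/seteqP; split => s /= [sd].
    move=> [t t01 pt]; split => // -[c cb [t' t'01]]; rewrite -pt => /sheet_inj.
    by move=> /(_ t'01 t01)[].
  move=> nc; split => //; move: sd; rewrite in_itv/= => /hp[c [t [t01 pt]]].
  have [<-|cb] := pselect (c = b); first by exists t.
  by exfalso; apply: nc; exists c => //; exists t.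
move=> _ sub s sd.
have /sub[_ [t t01 pt]] : (`]0, d[%classic) s by rewrite /= in_itv.
by exists t.
Qed.

(** A sheet is an open map on the unit interval, so its inverse is
    continuous. *)
Lemma sheet_lift_continuous (p : R -> M) (b : B) (gam : R -> R) (d s : R) :
  continuous p ->
  (forall s, 0 < s < d -> 0 < gam s < 1 /\ sheet b (gam s) = p s) ->
  0 < s < d -> {for s, continuous gam}.
Proof.
move=> cp hg sd W nW.
have [g01 gs] := hg _ sd.
have : nbhs (p s) (sheet b @` (interior W `&` [set t | 0 < t < 1])).
  apply: open_nbhs_nbhs; split.
    apply: sheet_open; last by move=> ? [].
    by apply: openI; [exact: open_interior|exact: open_unit_itv].
  by exists (gam s) => //; split.
move=> /cp /= nU.
have nd : \forall s' \near s, s' \in `]0, d[.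
  by apply: near_in_itvoo; rewrite in_itv.
rewrite nbhs_filterE/=; near=> s' => /=.
have : s' \in `]0, d[ by near: s'.
rewrite in_itv/= => s'd.
have [g'01 gs'] := hg _ s'd.
have : (p @^-1` (sheet b @` (interior W `&` [set t | 0 < t < 1]))) s' by near: s'.
move=> [t [Wt t01]]; rewrite -gs' => /sheet_inj[]// _ <-.
exact: interior_subset.
Unshelve. all: by end_near. Qed.

Lemma side_germ (p : R -> M) (d : R) :
  0 < d -> continuous p ->
  (forall s t, 0 < s < d -> 0 < t < d -> p s = p t -> s = t) ->
  (forall s, 0 < s < d -> exists b t, 0 < t < 1 /\ sheet b t = p s) ->
  exists b t0 dir u, [/\ 0 <= t0 <= 1, (if dir then t0 < 1 else 0 < t0),
    right_germ d u &
    forall s, 0 < s < d -> 0 < germ_param t0 dir (u s) < 1 /\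
      p s = sheet b (germ_param t0 dir (u s))].
Proof.
move=> d0 cp ip hp.
have [b hb] := path_in_one_sheet d0 cp hp.
have /choice[gam hg] : forall s, exists t,
    0 < s < d -> 0 < t < 1 /\ sheet b t = p s.
  move=> s; have [/hb[t ht]|] := pselect (is_true (0 < s < d)); first by exists t.
  by exists 0.
have [t0 [dir [u [t01 hdir gE hu]]]] : exists t0 dir u,
    [/\ 0 <= t0 <= 1, (if dir then t0 < 1 else 0 < t0),
    forall s, gam s = germ_param t0 dir (u s) & right_germ d u].
  apply: (@injective_right_germ _ gam d d0).
  - by move=> s /hg[].
  - by move=> s; exact: sheet_lift_continuous hg.
  - move=> s t sd td e; apply: ip => //.
    by rewrite -(hg _ sd).2 -(hg _ td).2 e.
exists b, t0, dir, u; split => // s sd.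
by rewrite -gE; have [? ->] := hg _ sd.
Qed.

End sheets.

(** * The two sides of a point of the manifold *)

Lemma right_germ_collision (R : realType) (d1 d2 e : R) (u1 u2 : R -> R) :
  0 < d1 -> 0 < d2 -> 0 < e -> right_germ d1 u1 -> right_germ d2 u2 ->
  exists s1 s2, [/\ 0 < s1 < d1, 0 < s2 < d2, s1 < e, s2 < e & u1 s1 = u2 s2].
Proof.
move=> d10 d20 e0 [u1p _ s1P] [u2p _ s2P].
have [a1 [a1d a1e]] : exists a, 0 < a < d1 /\ a <= e.
  exists (Num.min (d1 / 2) e); rewrite lt_min ge_min gt_min lexx orbT e0.
  by split => //; apply/andP; split; [apply/andP; lra|apply/orP; left; lra].
have [a2 [a2d a2e]] : exists a, 0 < a < d2 /\ a <= e.
  exists (Num.min (d2 / 2) e); rewrite lt_min ge_min gt_min lexx orbT e0.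
  by split => //; apply/andP; split; [apply/andP; lra|apply/orP; left; lra].
have := u1p _ a1d; have := u2p _ a2d => p2 p1.
pose t := Num.min (u1 a1) (u2 a2) / 2.
have m0 : 0 < Num.min (u1 a1) (u2 a2) by rewrite lt_min p1.
have m1 : Num.min (u1 a1) (u2 a2) <= u1 a1 by rewrite ge_min lexx.
have m2 : Num.min (u1 a1) (u2 a2) <= u2 a2 by rewrite ge_min lexx orbT.
have [|s1 s1a e1] := s1P _ t a1d; first by apply/andP; rewrite /t; lra.
have [|s2 s2a e2] := s2P _ t a2d; first by apply/andP; rewrite /t; lra.
by exists s1, s2; split; [apply/andP; lra|apply/andP; lra|lra|lra|rewrite e1].
Qed.

(** Without [phi 0] the finite set is closed and misses [phi 0]; injectivity
    keeps the other values of [phi] away from [phi 0] itself. *)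
Lemma punctured_chart_avoids (R : realType) (M : topologicalType) (phi : R -> M)
    (V : set M) :
  hausdorff_space M -> continuous phi -> injective phi -> finite_set V ->
  exists2 d : R, 0 < d & forall y, y != 0 -> `|y| < d -> ~ V (phi y).
Proof.
move=> hM cphi iphi fV.
have oV : open (~` (V `\ phi 0)).
  rewrite openC; have := hausdorff_accessible hM.
  by move=> /accessible_finite_set_closed; apply; exact: finite_setD.
have nV : nbhs (phi 0) (~` (V `\ phi 0)).
  by apply: open_nbhs_nbhs; split => // -[_]; exact.
have /nbhs_ballP[d /= d0 dV] := cphi _ _ nV.
exists d => // y y0 yd Vy.
apply: (dV y); first by rewrite /ball/= sub0r normrN.
by split => // /iphi /eqP; rewrite (negbTE y0).
Qed.

Section sides.
Variables (R : realType) (G : graph3 R) (hG : piecewise_C2_graph G).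

Lemma arc_cvg (T : Type) (F : set_system T) {FF : Filter F} (a : edge G)
    (t : R) (u : T -> R) :
  0 <= t <= 1 -> u @ F --> t -> (\forall x \near F, 0 <= u x <= 1) ->
  arc a (u x) @[x --> F] --> arc a t.
Proof.
move=> t01 ut u01; have [/(_ a)[_ _ [h [dh _ _ gh _]]] _ _] := hG.
rewrite gh//; apply: (@cvg_trans _ (h (u x) @[x --> F])).
  by apply: near_eq_cvg; apply: filterS u01 => x /gh ->.
by apply: (cvg_comp _ _ ut); exact: derivable_continuous.
Qed.

Variables (M : topologicalType) (f : M -> 'rV[R]_3).
Variable sheet : edge (double G) -> R -> M.
Hypothesis M_manifold : compact_1manifold R M.
Hypothesis f_cont : continuous f.
Hypothesis sheet_open : forall b (U : set R), open U ->
  U `<=` [set t | 0 < t < 1] -> open (sheet b @` U).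
Hypothesis sheet_inj : forall b c t s, 0 < t < 1 -> 0 < s < 1 ->
  sheet b t = sheet c s -> b = c /\ t = s.
Hypothesis f_sheet : forall b t, 0 < t < 1 -> f (sheet b t) = arc b t.
Hypothesis sheet_cover : forall m, (exists b t, 0 < t < 1 /\ sheet b t = m) \/
  (exists v : vertex (double G), f m = pos (double G) v).
Hypothesis fibre_finite : forall q, graph_support G q ->
  finite_set [set m | f m = q].

Definition end_germ (g : edge G * R * bool) (s : R) := germ_param g.1.2 g.2 s.

Definition side_param (sg : bool) (s : R) := if sg then s else - s.

(** Meant for a chart [p] with [p 0 = m]: the side [sg] of [m], with parameter
    [s > 0], runs along the end [(E sg).1] of [G] in the copy [(E sg).2] of that edge, at
    parameter distance [u sg s] from the end point. *)
Definition side_ends (m : M) (p : R -> M) (d : R)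
    (E : bool -> (edge G * R * bool) * bool) (u : bool -> R -> R) :=
  forall sg, [/\ edge_ends G (f m) (E sg).1, right_germ d (u sg) &
    forall s, 0 < s < d -> 0 < end_germ (E sg).1 (u sg s) < 1 /\
     p (side_param sg s) =
       sheet ((E sg).1.1.1, (E sg).2) (end_germ (E sg).1 (u sg s))].

Lemma vertex_fibre_finite : finite_set [set m | exists v, f m = pos G v].
Proof.
rewrite (_ : mkset _ = \bigcup_(v in [set: vertex G]) [set m | f m = pos G v]).
  apply: bigcup_finite; first exact: finite_finset.
  by move=> v _; apply: fibre_finite; left; exists v.
by apply/seteqP; split => m /=; [move=> [v fv]; exists v|move=> [v _ fv]; exists v].
Qed.

(** The parameter of the end is the limit given by [side_germ]; it lies over
    [f m] because [f] and the arcs are continuous up to the limit. *)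
Lemma point_sides (m : M) : exists p d E u,
  [/\ continuous p, injective p, (forall U : set R, open U -> open (p @` U)),
      p 0 = m & 0 < d] /\ side_ends m p d E u.
Proof.
have [hM _ /(_ m)[phi [cphi iphi ophi [x phix]]]] := M_manifold.
pose p y := phi (x + y).
have cp : continuous p.
  move=> y; apply: (@continuous_comp _ _ _ (fun y => x + y) phi); last exact: cphi.
  by apply: cvgD; [exact: cvg_cst|exact: cvg_id].
have ip : injective p by move=> y z /iphi/addrI.
have p0 : p 0 = m by rewrite /p addr0.
have op (U : set R) : open U -> open (p @` U).
  move=> oU; rewrite (_ : p @` U = phi @` ((fun y => y - x) @^-1` U)).
    apply: ophi; apply: open_comp => // y _.
    by apply: cvgB; [exact: cvg_id|exact: cvg_cst].
  apply/seteqP; split => n /= [y Uy <-].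
    by exists (x + y) => //=; rewrite addrC addKr.
  by exists (y - x) => //; rewrite /p subrKC.
have [d d0 dV] := punctured_chart_avoids hM cp ip vertex_fibre_finite.
have side sg : exists w : ((edge G * R * bool) * bool) * (R -> R),
    [/\ edge_ends G (f m) w.1.1, right_germ d w.2 &
    forall s, 0 < s < d -> 0 < end_germ w.1.1 (w.2 s) < 1 /\
     p (side_param sg s) = sheet (w.1.1.1.1, w.1.2) (end_germ w.1.1 (w.2 s))].
  have cs : continuous (p \o side_param sg).
    move=> y; apply: continuous_comp; last exact: cp.
    by rewrite /side_param; case: sg; [exact: cvg_id|apply: cvgN; exact: cvg_id].
  have [| |b [t0 [dir [u [t01 hdir hu hp]]]]] :=
    side_germ sheet_open sheet_inj d0 cs.
  - by move=> s t _ _ /= /ip; rewrite /side_param; case: (sg) => // /oppr_inj.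
  - move=> s sd; have [//|[v fv]] := sheet_cover (p (side_param sg s)).
    exfalso; apply: (dV (side_param sg s)); last by exists v.
      by rewrite /side_param; case: (sg); rewrite ?oppr_eq0 gt_eqF//; lra.
    by rewrite /side_param; case: (sg); rewrite ?normrN gtr0_norm; lra.
  exists ((b.1, t0, dir), b.2, u); split => //=; last by case: b hp.
  split => //=.
  have [up ul _] := hu.
  have nd : \forall s \near 0^'+, 0 < s < d.
    near=> s; apply/andP; split;
  near: s; [exact: nbhs_right_gt|exact: nbhs_right_lt].
  have lim1 : f (p (side_param sg s)) @[s --> 0^'+] --> f m.
    rewrite -p0; apply: cvg_at_right_filter.
    have -> : f (p 0) = (f \o (p \o side_param sg)) 0.
      by rewrite /= /side_param; case: (sg); rewrite ?oppr0.
    have cf : continuous (f \o (p \o side_param sg)).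
      by move=> y; apply: continuous_comp; [exact: cs|exact: f_cont].
    exact: cf.
  have lim2 : arc b.1 (germ_param t0 dir (u s)) @[s --> 0^'+] --> arc b.1 t0.
    apply: arc_cvg => //.
      rewrite -[X in _ --> X](_ : germ_param t0 dir 0 = t0); last first.
        by rewrite /germ_param; case: dir {hdir hp}; rewrite ?addr0 ?subr0.
      rewrite /germ_param; case: dir {hdir hp};
      [apply: cvgD => //; exact: cvg_cst|apply: cvgB => //; exact: cvg_cst].
    by apply: filterS nd => s /hp[/andP[/ltW -> /ltW ->]].
  apply: (norm_cvg_unique lim2).
  apply: cvg_trans lim1; apply: near_eq_cvg; apply: filterS nd => s sd.
  by have [s01 /= e] := hp _ sd; rewrite e f_sheet.
have /choice[w hw] := side.
by exists p, d, (fun sg => (w sg).1), (fun sg => (w sg).2).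
Unshelve. all: by end_near. Qed.

(** Two sides along one end visit common points arbitrarily close to both base
    points.  So the base points agree since [M] is Hausdorff, and then the
    injective chart puts both points on the same side. *)
Lemma side_ends_inj m1 p1 d1 E1 u1 m2 p2 d2 E2 u2 sg1 sg2 :
  continuous p1 -> injective p1 -> p1 0 = m1 -> 0 < d1 ->
  side_ends m1 p1 d1 E1 u1 ->
  continuous p2 -> injective p2 -> p2 0 = m2 -> 0 < d2 ->
  side_ends m2 p2 d2 E2 u2 ->
  (m1 = m2 -> p1 = p2) ->
  E1 sg1 = E2 sg2 -> m1 = m2 /\ sg1 = sg2.
Proof.
move=> cp1 ip1 p10 d10 h1 cp2 ip2 p20 d20 h2 p12 E12.
have [_ g1 e1] := h1 sg1; have [_ g2 e2] := h2 sg2.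
have near0 m (p : R -> M) (A : set M) : continuous p -> p 0 = m -> nbhs m A ->
    exists2 r, 0 < r & forall sg s, 0 < s < r -> A (p (side_param sg s)).
  move=> cp p0 nA; rewrite -p0 in nA.
  have /nbhs_ballP[r /= r0 rA] := cp _ _ nA; exists r => // sg s s0r.
  apply: rA; rewrite /ball/= sub0r normrN /side_param.
  by case: sg; rewrite ?normrN gtr0_norm; lra.
have coll e : 0 < e -> exists s1 s2, [/\ 0 < s1 < e, 0 < s2 < e &
    p1 (side_param sg1 s1) = p2 (side_param sg2 s2)].
  move=> e0; have [s1 [s2 [s1d s2d s1e s2e u12]]] :=
    right_germ_collision d10 d20 e0 g1 g2.
  exists s1, s2; split; [apply/andP; lra|apply/andP; lra|].
  by rewrite (e1 _ s1d).2 (e2 _ s2d).2 E12 u12.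
have m12 : m1 = m2.
  apply/eqP; apply: contraT => /eqP m12.
  have [hM _ _] := M_manifold; move: hM.
  rewrite open_hausdorff => /(_ _ _ (introN eqP m12)).
  move=> [[A1 A2] /= [mA1 mA2] [oA1 oA2 A12]].
  rewrite inE in mA1; rewrite inE in mA2.
  have [r1 r10 h1'] := near0 _ _ _ cp1 p10 (open_nbhs_nbhs (conj oA1 mA1)).
  have [r2 r20 h2'] := near0 _ _ _ cp2 p20 (open_nbhs_nbhs (conj oA2 mA2)).
  have r120 : 0 < Num.min r1 r2 by rewrite lt_min r10.
  have [s1 [s2 [/andP[s10 s1r] /andP[s20 s2r] ps]]] := coll _ r120.
  have : (A1 `&` A2) (p1 (side_param sg1 s1)).
    move: s1r s2r; rewrite !lt_min => /andP[s1r _] /andP[_ s2r].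
    by split; [apply: h1'; rewrite s10|rewrite ps; apply: h2'; rewrite s20].
  by move/eqP: A12 => ->.
split => //; have [s1 [s2 [s1d s2d]]] := coll 1 ltr01.
rewrite -(p12 m12) => /ip1; rewrite /side_param.
by case: sg1 {e1 coll g1 E12}; case: sg2 {e2 g2} => //; lra.
Qed.

End sides.

(** * Up ends, down ends and local extrema *)

Section up_down.
Variables (R : realType) (G : graph3 R).

Definition up_end (e q : 'rV[R]_3) (g : edge G * R * bool) :=
  \forall s \near 0^'+, dot e q < dot e (along g s).

Definition down_end (e q : 'rV[R]_3) (g : edge G * R * bool) :=
  \forall s \near 0^'+, dot e (along g s) < dot e q.

Definition noncritical (e : 'rV[R]_3) :=
  forall a : edge G, exists h : R -> 'rV[R]_3,
  [/\ forall t, derivable h t 1, forall t, derivable (derive1 h) t 1,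
      forall t, 0 <= t <= 1 -> arc a t = h t &
      forall t, 0 <= t <= 1 ->
        ~ (dot e (derive1 h t) = 0 /\ dot e (derive1 (derive1 h) t) = 0)].

Lemma up_endN e q g : up_end (- e) q g <-> down_end e q g.
Proof. by split; apply: filterS => s; rewrite !dotNl ltrN2. Qed.

Lemma down_endN e q g : down_end (- e) q g <-> up_end e q g.
Proof. by split; apply: filterS => s; rewrite !dotNl ltrN2. Qed.

Lemma noncriticalN e : noncritical e -> noncritical (- e).
Proof.
move=> ce a; have [h [dh d2h ah ch]] := ce a; exists h; split => // t t01.
have dotN0 v : dot (- e) v = 0 -> dot e v = 0.
  by rewrite dotNl => /eqP; rewrite oppr_eq0 => /eqP.
by move=> [/dotN0 e1 /dotN0 e2]; exact: (ch t).
Qed.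

Lemma up_down_end_contra e q g : up_end e q g -> down_end e q g -> False.
Proof.
move=> u d.
have [] := @filter_ex _ _ (at_right_proper_filter (0 : R)) _ (filterI u d).
by move=> s [/lt_trans h /h]; rewrite ltxx.
Qed.

(** The height along the end is [psi s = dot e (h (t + c s))] with [c] equal to
    1 or -1, so its derivatives at 0 are [c] and [c ^ 2] times those of the
    height at [t]. *)
Lemma edge_end_up_or_down e q g : noncritical e -> edge_ends G q g ->
  up_end e q g \/ down_end e q g.
Proof.
case: g => [[a t] dir] /(_ a)[h [dh d2h ah ch]] [/= t01 aq hdir].
pose c : R := if dir then 1 else -1.
pose psi s := dot e (h (t + c * s)).
pose dpsi s := c * dot e (derive1 h (t + c * s)).
have dlin (s : R) : is_derive s 1 (fun s => t + c * s) c.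
  have := is_deriveD (is_derive_cst t s 1) (is_deriveZ c (is_derive_id s 1)).
  by rewrite add0r scaler1.
have comp (k : R -> 'rV[R]_3) : (forall s, derivable k s 1) -> forall s : R,
    is_derive s 1 (fun s => dot e (k (t + c * s)))
      (dot e (derive1 k (t + c * s)) * c).
  move=> dk s.
  exact: (@is_derive1_comp R (fun x => dot e (k x)) (fun s => t + c * s) s _ _
    (is_derive_dot e (dk (t + c * s))) (dlin s)).
have dp (s : R) : is_derive s 1 psi (dpsi s).
  by rewrite /dpsi mulrC; exact: comp.
have d2p : is_derive (0 : R) 1 dpsi
    (c * (dot e (derive1 (derive1 h) (t + c * 0)) * c)).
  exact: (is_deriveZ c (comp _ d2h 0)).
have c0 : c != 0 by rewrite /c; case: (dir); rewrite ?oppr_eq0 oner_neq0.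
have nz : ~ (dpsi 0 = 0 /\
    c * (dot e (derive1 (derive1 h) (t + c * 0)) * c) = 0).
  rewrite /dpsi mulr0 addr0 => -[/eqP + /eqP].
  rewrite !mulf_eq0 (negbTE c0) /= orbF => /eqP h1 /eqP h2.
  by apply: (ch t).
have q0 : psi 0 = dot e q by rewrite /psi mulr0 addr0 -ah// aq.
have nE : \forall s \near (0 : R)^'+, psi s = dot e (along ((a, t), dir) s).
  have [l l0 hl] : exists2 l : R, 0 < l &
      forall s, 0 < s < l -> 0 <= t + c * s <= 1.
    exists (if dir then 1 - t else t).
      by move: hdir; case: (dir) => //; rewrite subr_gt0.
    by move=> s; rewrite /c; case: (dir); lra.
  near=> s; rewrite /along/= /psi -ah.
    by rewrite /c; case: (dir); rewrite ?mul1r ?mulN1r.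
  apply: hl; apply/andP; split;
  near: s; [exact: nbhs_right_gt|exact: nbhs_right_lt].
have [up|dn] := near_right_strict_sign dp d2p nz; [left|right].
- by apply: filterS2 nE up => s <-; rewrite q0.
- by apply: filterS2 nE dn => s <-; rewrite q0.
Unshelve. all: by end_near. Qed.

Lemma right_germ_near (d : R) (u : R -> R) (P : R -> Prop) :
  0 < d -> right_germ d u ->
  (\forall s \near 0^'+, P s) -> \forall s \near 0^'+, P (u s).
Proof.
move=> d0 [u0 ul _] [r /= r0 rP].
near=> s; apply: rP => /=.
  near: s; exact: ((@cvgrPdist_lt _ _ _ _ _ _ _).1 ul).
by apply: u0; apply/andP; split;
  near: s; [exact: nbhs_right_gt|exact: nbhs_right_lt].
Unshelve. all: by end_near. Qed.

Section local_extrema.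
Variables (M : topologicalType) (f : M -> 'rV[R]_3).
Variable sheet : edge (double G) -> R -> M.
Hypothesis f_sheet : forall b t, 0 < t < 1 -> f (sheet b t) = arc b t.
Variables (m : M) (p : R -> M) (d : R).
Variables (E : bool -> (edge G * R * bool) * bool) (u : bool -> R -> R).
Hypotheses (p_cont : continuous p)
  (p_open : forall U : set R, open U -> open (p @` U)) (p0 : p 0 = m)
  (d_gt0 : 0 < d)
  (hE : side_ends f sheet m p d E u).

Lemma near_side_value sg : \forall s \near 0^'+,
  f (p (side_param sg s)) = along (E sg).1 (u sg s).
Proof.
have [_ _ h] := hE sg; near=> s.
have [g01 ->] : 0 < end_germ (E sg).1 (u sg s) < 1 /\ p (side_param sg s) =
    sheet ((E sg).1.1.1, (E sg).2) (end_germ (E sg).1 (u sg s)).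
  by apply: h; apply/andP; split;
  near: s; [exact: nbhs_right_gt|exact: nbhs_right_lt].
by rewrite f_sheet.
Unshelve. all: by end_near. Qed.

(** The two sides together with [m] fill a neighbourhood of [m], since the chart
    is open; and a side that is not down is up. *)
Lemma local_max_sides e : noncritical e ->
  (\forall m' \near m, dot e (f m') <= dot e (f m)) <->
  (forall sg, down_end e (f m) (E sg).1).
Proof.
move=> ce; split => [mx sg|dn].
- have [gE hu _] := hE sg.
  have [up|//] := edge_end_up_or_down ce gE; exfalso.
  have h1 := right_germ_near d_gt0 hu up; have h2 := near_side_value sg.
  have h3 : \forall s \near (0 : R)^'+,
      dot e (f (p (side_param sg s))) <= dot e (f m).
    rewrite -p0 in mx.
    have /nbhs_ballP[r /= r0 rA] := p_cont mx; near=> s; rewrite -p0.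
    have s0 : 0 < s by near: s; exact: nbhs_right_gt.
    have sr : s < r by near: s; exact: nbhs_right_lt.
    apply: rA; rewrite /ball/= sub0r normrN /side_param.
    by case: (sg); rewrite ?normrN gtr0_norm.
  have [s [[+ ->]]] := @filter_ex _ _ (at_right_proper_filter (0 : R)) _
    (filterI (filterI h1 h2) h3).
  by move=> /lt_le_trans h /h; rewrite ltxx.
- have side sg : \forall s \near (0 : R)^'+,
      dot e (f (p (side_param sg s))) <= dot e (f m).
    have [gE hu _] := hE sg.
    apply: filterS2 (right_germ_near d_gt0 hu (dn sg)) (near_side_value sg).
    by move=> s /ltW + ->.
  have [r1 /= r10 h1] := side true; have [r2 /= r20 h2] := side false.
  pose U : set R := ball (0 : R) (Num.min r1 r2).
  have nU : nbhs m (p @` U).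
    apply: open_nbhs_nbhs; split; first by apply: p_open; exact: ball_open.
    by exists 0 => //; rewrite /U /ball/= subrr normr0 lt_min r10.
  apply: filterS nU => _ [y + <-].
  rewrite /U /ball/= sub0r normrN lt_min => /andP[y1 y2].
  have [y0|y0|->] := ltgtP y 0; last by rewrite p0.
  + have := h2 (- y); rewrite /side_param opprK; apply; last by rewrite oppr_gt0.
    by rewrite /ball_/= sub0r opprK.
  + by apply: (h1 y) => //; rewrite /= sub0r normrN.
Unshelve. all: by end_near. Qed.

End local_extrema.

End up_down.

(** * Counting sides and ends *)

Lemma ncard_count (T : choiceType) (A : set T) (P : T -> Prop) :
  finite_set A ->
  ncard [set x | A x /\ P x] = count (fun x => `[< P x >]) (fset_set A).
Proof.
move=> fA; rewrite /ncard -size_filter; apply: perm_size; apply: uniq_perm.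
- exact: fset_uniq.
- exact/filter_uniq/fset_uniq.
have fAP : finite_set [set x | A x /\ P x] by apply: sub_finite_set fA => x [].
move=> x; rewrite mem_filter !in_fset_set//.
by apply/idP/andP; rewrite !inE/= => -[? ?]; split => //; apply/asboolP.
Qed.

Section doubled_lists.
Variables (S T : eqType).

(** Serves both for the sides of a list of points and for the two copies in the
    double of a list of edge ends. *)
Definition doubled (A : eqType) (s : seq A) : seq (A * bool) :=
  [seq (x, true) | x <- s] ++ [seq (x, false) | x <- s].

Lemma mem_doubled (A : eqType) (s : seq A) x b :
  ((x, b) \in doubled s) = (x \in s).
Proof.
rewrite mem_cat; apply/orP/idP => [[|]/mapP[y ys [-> _]]//|xs].
by case: b; [left|right]; apply: map_f.
Qed.

Lemma doubled_uniq (A : eqType) (s : seq A) : uniq s -> uniq (doubled s).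
Proof.
move=> us.
have inj (b : bool) : injective (fun x : A => (x, b)) by move=> x y [].
rewrite cat_uniq !(map_inj_uniq (inj _)) us/= andbT.
by apply/hasPn => _ /mapP[x _ ->]; apply/negP => /mapP[].
Qed.

Lemma count_doubled (A : eqType) (s : seq A) (P : pred (A * bool)) :
  count P (doubled s) =
  (count (fun x => P (x, true)) s + count (fun x => P (x, false)) s)%N.
Proof. by rewrite count_cat !count_map. Qed.

(** [E] is an injection of the doubled [Q] into the doubled [D], which have the
    same length, so it is a bijection and preserves the number of elements
    satisfying [P]. *)
Lemma count_doubled_bijection (Q : seq S) (D : seq T) (E : S -> bool -> T * bool)
    (P : pred T) :
  uniq Q -> size Q = size D ->
  (forall x y b c, x \in Q -> y \in Q -> E x b = E y c -> x = y /\ b = c) ->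
  (forall x b, x \in Q -> (E x b).1 \in D) ->
  (count (fun x => P (E x true).1) Q + count (fun x => P (E x false).1) Q
   = (count P D).*2)%N.
Proof.
move=> uQ sQD Einj ED.
pose F xb := E xb.1 xb.2.
have uF : uniq (map F (doubled Q)).
  rewrite map_inj_in_uniq ?doubled_uniq// => -[x b] [y c].
  rewrite !mem_doubled /F/= => xQ yQ e.
  by have [-> ->] := Einj _ _ _ _ xQ yQ e.
have sub : {subset map F (doubled Q) <= doubled D}.
  move=> _ /mapP[[x b] xQ ->]; rewrite mem_doubled in xQ.
  have := ED x b xQ; rewrite /F/=; case: (E x b) => g c /=.
  by rewrite mem_doubled.
have szd (A : eqType) (s : seq A) : size (doubled s) = (size s).*2.
  by rewrite size_cat !size_map addnn.
have [|_ eqFD] := uniq_min_size uF sub; first by rewrite size_map !szd sQD.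
have uD : uniq (doubled D).
  by rewrite -(eq_uniq _ eqFD)// size_map !szd sQD.
have /permP/(_ (fun tb => P tb.1)) := uniq_perm uF uD eqFD.
by rewrite count_map !count_doubled/= addnn.
Qed.

(** With [a] and [b] the predicates [P] on the two sides, the count of [a] plus
    the count of [b] is twice the count of [P] on [D], and inclusion-exclusion
    turns it into the counts of both and of neither. *)
Lemma count_both_sides (Q : seq S) (D : seq T) (E : S -> bool -> T * bool)
    (P : pred T) :
  uniq Q -> size Q = size D ->
  (forall x y b c, x \in Q -> y \in Q -> E x b = E y c -> x = y /\ b = c) ->
  (forall x b, x \in Q -> (E x b).1 \in D) ->
  (count (fun x => P (E x true).1 && P (E x false).1) Q + count (predC P) D
   = count (fun x => ~~ P (E x true).1 && ~~ P (E x false).1) Q + count P D)%N.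
Proof.
move=> uQ sQD Einj ED.
have := count_doubled_bijection P uQ sQD Einj ED.
set a := fun x => P (E x true).1; set b := fun x => P (E x false).1.
rewrite -count_predUI.
have := count_predC P D; rewrite -sQD -(count_predC (predU a b) Q).
have -> : count (fun x => ~~ a x && ~~ b x) Q = count (predC (predU a b)) Q.
  by apply: eq_count => x /=; rewrite negb_or.
have -> : count (fun x => a x && b x) Q = count (predI a b) Q by [].
lia.
Qed.

End doubled_lists.

Section edge_ends_finite.
Variables (R : realType) (G : graph3 R).

(** By embeddedness at most one point of the open edges lies at [q]; all other
    ends have parameter 0 or 1. *)
Lemma finite_edge_ends (q : 'rV[R]_3) : embedded G -> finite_set (edge_ends G q).
Proof.
move=> [_ inj _].
pose I := [set at_ : edge G * R | 0 < at_.2 < 1 /\ arc at_.1 at_.2 = q].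
have fI : finite_set I.
  have [->|/set0P[[a t] [/= t01 aq]]] := eqVneq I set0; first exact: finite_set0.
  apply: (@sub_finite_set _ _ [set (a, t)]); last exact: finite_set1.
  move=> [b s] [/= s01 bq]; have [] := inj a b t s t01 s01; first by rewrite aq.
  by move=> -> ->.
apply: (@sub_finite_set _ _
  (([set: edge G] `*` [set 0; 1] `|` I) `*` [set: bool])).
  move=> [[a t] dir] [/= /andP[t0 t1] aq _]; split => //=.
  move: t0 t1; rewrite le_eqVlt => /predU1P[<-|t0].
    by left; split => //; left.
  rewrite le_eqVlt => /predU1P[->|t1]; first by left; split => //; right.
  by right; split => //=; rewrite t0.
apply: finite_setX; last exact: finite_finset.
rewrite finite_setU; split => //; apply: finite_setX; first exact: finite_finset.
exact: finite_set2.
Qed.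

End edge_ends_finite.

(** * The combinatorial lemma *)

Section noncritical_directions.
Variables (R : realType) (G : graph3 R).

Lemma unit_coord_le1 (e : 'rV[R]_3) i : dot e e = 1 -> `|e ord0 i| <= 1.
Proof.
move=> e1; rewrite -(@expr_le1 _ 2)// real_normK ?num_real// -e1.
rewrite /dot (bigD1 i)//=.
by rewrite expr2 lerDl sumr_ge0// => j _; rewrite -expr2 sqr_ge0.
Qed.

Lemma ae_noncritical : piecewise_C2_graph G -> ae_sphere (noncritical G).
Proof.
move=> [hG _ _].
have /choice[h hh] : forall a : edge G, exists h : R -> 'rV[R]_3,
   [/\ forall t, derivable h t 1, forall t, derivable (derive1 h) t 1,
    continuous (derive1n 2 h), forall t, 0 <= t <= 1 -> arc a t = h t &
        forall t, 0 <= t <= 1 -> derive1 h t != 0].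
  by move=> a; have [_ _ [h ?]] := hG a; exists h.
pose m3 := product_measure1
  (sigma_finite_product (@lebesgue_measure R) (@lebesgue_measure R))
  (@lebesgue_measure R).
have n3 : m3.-negligible (\bigcup_a critical_cone (h a)).
  apply: negligible_finite_bigcup => a.
  have [dh d2h ch _ h0] := hh a; exact: (negligible_critical_cone dh d2h ch h0).
apply: (@negligibleS _ _ _ _ _ _ _ n3).
move=> p [t [e [t0 t1 [e1 nce] pe]]]; apply: contrapT => np; apply: nce => a.
have [dh d2h ch ah h0] := hh a; exists (h a); split => // s s01 [c1 c2].
apply: np; exists a => //; split.
  move=> i; rewrite pe mxE normrM (gtr0_norm t0).
  by apply: mulr_ile1 => //; [exact: ltW|exact: unit_coord_le1].
have dotZ0 v : dot e v = 0 -> dot (vec3 p) v = 0.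
  by rewrite pe dotZl => ->; rewrite mulr0.
by exists s => //; split; [exact: (dotZ0 _ c1)|exact: (dotZ0 _ c2)].
Qed.

(** Stated without subtraction in the natural numbers.  Local minima are the
    local maxima for [- e], whose down ends are the up ends for [e]. *)
Lemma nlm_noncritical (M : topologicalType) (f : M -> 'rV[R]_3) (e q : 'rV[R]_3) :
  piecewise_C2_graph G -> double_parameterization G f -> noncritical G e ->
  graph_support G q ->
  (lmax f e q + up_degree G e q = lmin f e q + down_degree G e q)%N.
Proof.
move=> hG [hM cf [sheet [_ so si fs cov]] fib] ce Gq.
have fibre_fin q' : graph_support G q' -> finite_set [set m | f m = q'].
  by move=> /fib h; exists (degree G q').
have sides := point_sides hG hM cf so si fs cov fibre_fin.
have /choice[w hw] : forall m, exists w : ((R -> M) * R) *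
    ((bool -> (edge G * R * bool) * bool) * (bool -> R -> R)),
    [/\ continuous w.1.1, injective w.1.1,
      (forall U : set R, open U -> open (w.1.1 @` U)), w.1.1 0 = m & 0 < w.1.2] /\
    side_ends f sheet m w.1.1 w.1.2 w.2.1 w.2.2.
  by move=> m; have [p [d [E [u hm]]]] := sides m; exists ((p, d), (E, u)).
pose E m := (w m).2.1.
have fE : finite_set (edge_ends G q).
  by case: hG => _ emb _; exact: finite_edge_ends.
have fQ := fibre_fin q Gq.
pose Q : seq M := fset_set [set m | f m = q].
pose D : seq (edge G * R * bool) := fset_set (edge_ends G q).
have memQ m : m \in Q -> f m = q by rewrite in_fset_set// inE.
pose P (g : edge G * R * bool) := `[< down_end e q g >].
have notP g : g \in D -> ~~ P g = `[< up_end e q g >].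
  rewrite in_fset_set// inE => /(edge_end_up_or_down ce) ud; apply/idP/idP.
    by move=> /asboolP nd; apply/asboolP; case: ud.
  by move=> /asboolP up; apply/negP => /asboolP; exact: up_down_end_contra up.
have ED m b : m \in Q -> (E m b).1 \in D.
  move=> mQ; rewrite in_fset_set// inE -(memQ _ mQ).
  by have [_ /(_ b)[]] := hw m.
have lmaxE : lmax f e q = count (fun m => P (E m true).1 && P (E m false).1) Q.
  rewrite /lmax ncard_count//; apply: eq_in_count => m mQ.
  have [[cp _ op p0 d0] hs] := hw m.
  have := local_max_sides fs cp op p0 d0 hs ce; rewrite (memQ _ mQ) => mx.
  apply/asboolP/andP => [/mx dn|[/asboolP dt /asboolP df]].
    by split; apply/asboolP; exact: dn.
  by apply/mx => -[].
have lminE : lmin f e q =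
    count (fun m => ~~ P (E m true).1 && ~~ P (E m false).1) Q.
  rewrite /lmin ncard_count//; apply: eq_in_count => m mQ.
  have [[cp _ op p0 d0] hs] := hw m.
  rewrite !notP ?ED//.
  have := local_max_sides fs cp op p0 d0 hs (noncriticalN ce).
  rewrite (memQ _ mQ) => mx.
  have mnE : (\forall m' \near m, dot e q <= dot e (f m')) <->
      (\forall m' \near m, dot (- e) (f m') <= dot (- e) q).
    by split; apply: filterS => m'; rewrite !dotNl lerN2.
  apply/asboolP/andP => [/mnE/mx dn|[/asboolP ut /asboolP uf]].
    by split; apply/asboolP/down_endN; exact: dn.
  by apply/mnE/mx => -[]; apply/down_endN.
have downE : down_degree G e q = count P D by rewrite /down_degree ncard_count.
have upE : up_degree G e q = count (predC P) D.
  rewrite /up_degree ncard_count//; apply: eq_in_count => g gD /=.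
  by rewrite notP.
rewrite lmaxE lminE downE upE; apply: count_both_sides => //.
- exact: fset_uniq.
- exact: (card_fset_set (fib q Gq)).
- move=> m1 m2 b c _ _ e12.
  have [[cp1 ip1 _ p10 d10] hs1] := hw m1.
  have [[cp2 ip2 _ p20 d20] hs2] := hw m2.
  apply: (side_ends_inj hM cp1 ip1 p10 d10 hs1 cp2 ip2 p20 d20 hs2 _ e12).
  by move=> ->.
Qed.

End noncritical_directions.

Theorem lemma1 (R : realType) (G : graph3 R) (hG : piecewise_C2_graph G)
    (M : topologicalType) (f : M -> 'rV[R]_3)
    (hf : double_parameterization G f) :
  ae_sphere (fun e : 'rV[R]_3 => forall q : 'rV[R]_3, graph_support G q ->
    nlm f e q = 2^-1 * ((down_degree G e q)%:R - (up_degree G e q)%:R)).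
Proof.
have [N [mN N0 sN]] := ae_noncritical hG.
exists N; split => // p [t [e [t0 t1 [e1 ne] pe]]]; apply: sN.
exists t, e; split => //; split => // ce; apply: ne => q Gq.
have /(congr1 (fun n => n%:R : R)) := nlm_noncritical hG hf ce Gq.
by rewrite !natrD /nlm => h; congr (_ * _); lra.
Qed.
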